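(* Let $a>b\ge 1$ be integers, put $a_1=a$, $a_2=b$, and let $a_1,a_2,\dots,a_{k+1},a_{k+2}=0$ be the sequence of integers produced by Euclid's algorithm on $(a,b)$. Let $R_{a,b}(c)$ denote the number of recursive function calls incurred by the DEA-R algorithm on input $(a,b,c)$, regarded as a function of the integer $c$. Then the function $c\mapsto R_{a,b}(c)$ is periodic and its fundamental (least positive) period is $\operatorname{lcm}(a_2,a_3,\dots,a_{k+1})$.
   Context: Euclid's sequence: for integers $a_1>a_2\ge 1$, define $a_{i+2}=a_i \bmod a_{i+1}$ (the remainder of $a_i$ divided by $a_{i+1}$) as long as $a_{i+1}\neq 0$; $k$ is the index such that $a_{k+1}\ne 0$ and $a_{k+2}=0$, so $a_{k+1}=\gcd(a_1,a_2)$. Thus Euclid's algorithm on $(a_1,a_2)$ makes $k+1$ calls, with successive arguments $(a_1,a_2),(a_2,a_3),\dots,(a_k,a_{k+1}),(a_{k+1},0)$. DEA-R algorithm (a recursive algorithm for solving $ax+by=c$ in integers; it returns a value of $y$). It is the recursive function $f(a,b,c)$ defined as follows: 1. If $b=0$, report that there is no solution and stop. 2. Otherwise, if $(c-a) \bmod b=0$, return $(c-a)/b$. 3. Otherwise, return $\bigl(c-f(b,\,a \bmod b,\,c)\cdot a\bigr)/b$. The number of recursive function calls on input $(a,b,c)$ is the total number of calls to $f$, including the initial one. The $i$-th call, if it is reached, has arguments $(a_i,a_{i+1},c)$. Writing $\mathbf{c_i}=\{a_i+Q a_{i+1}: Q\in\mathbb{Z}\}$ for $1\le i\le k$, this means that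 $R_{a,b}(c)=i$ if $c\in\mathbf{c_i}$ and $c\notin\mathbf{c_j}$ for all $j<i$, and $R_{a,b}(c)=k+1$ if $c$ lies in none of $\mathbf{c_1},\dots,\mathbf{c_k}$ (equivalently, if $ax+by=c$ has no integer solution). *)

(* Defs.v *)
From mathcomp Require Import all_boot all_order all_algebra.

Set Implicit Arguments.
Unset Strict Implicit.
Unset Printing Implicit Defensive.

Import Order.TTheory GRing.Theory Num.Theory.
Local Open Scope ring_scope.

(* DEA-R instrumented with a call counter: the first component is the value
   returned ([None] = "no solution"), the second the number of calls made,
   including the initial one.  [fuel] only serves to make the recursion
   structural; by [dearE] below it is never exhausted, and [dear] satisfies the
   recursive equation of the algorithm for all integers a, b, c. *)
Fixpoint dear_rec (fuel : nat) (a b c : int) : option int * nat :=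
  if fuel is fuel'.+1 then
    if b == 0 then (None, 1%N)
    else if ((c - a) %% b)%Z == 0 then (Some ((c - a) %/ b)%Z, 1%N)
    else let: (r, n) := dear_rec fuel' b (a %% b)%Z c in
         (omap (fun y => ((c - y * a) %/ b)%Z) r, n.+1)
  else (None, 0%N).

Definition dear (a b c : int) : option int * nat :=
  dear_rec (absz b).+1 a b c.

Definition dear_calls (a b c : int) : nat := (dear a b c).2.

Lemma absz_modz_lt (a b : int) : b != 0 -> (absz (a %% b)%Z < absz b)%N.
Proof.
by move=> b0; rewrite -ltz_nat (gez0_abs (modz_ge0 a b0)) abszE ltz_mod.
Qed.

Lemma dear_rec_fuel (m n : nat) (a b c : int) :
  (absz b < m)%N -> (absz b < n)%N -> dear_rec m a b c = dear_rec n a b c.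
Proof.
elim: m n a b => [|m IH] [|n] a b //= ltm ltn.
case: ifPn => // b0; case: ifP => // _.
have lt_ab := absz_modz_lt a b0.
by rewrite (IH n) ?(leq_trans lt_ab).
Qed.

Lemma dearE (a b c : int) :
  dear a b c =
    if b == 0 then (None, 1%N)
    else if ((c - a) %% b)%Z == 0 then (Some ((c - a) %/ b)%Z, 1%N)
    else let: (r, n) := dear b (a %% b)%Z c in
         (omap (fun y => ((c - y * a) %/ b)%Z) r, n.+1).
Proof.
rewrite {1}/dear /=; case: ifPn => // b0; case: ifP => // _.
have lt_ab := absz_modz_lt a b0.
by rewrite /dear (@dear_rec_fuel _ (absz (a %% b)%Z).+1).
Qed.

(* [s 1, ..., s k.+2] is Euclid's sequence of (a, b), indexed from 1 and
   stopping at its first zero [s k.+2]; the other values of [s] are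
   irrelevant. *)
Definition euclid_seq (a b : int) (k : nat) (s : nat -> int) : Prop :=
  [/\ s 1%N = a, s 2%N = b,
      forall i : nat, (1 <= i <= k)%N ->
        s i.+1 != 0 /\ s i.+2 = (s i %% s i.+1)%Z,
      s k.+1 != 0 & s k.+2 = 0].

Lemma euclid_seq_exists (a b : int) :
  a != 0 -> exists k s, euclid_seq a b k s.
Proof.
have [m] := ubnP (absz b); elim: m a b => // m IH a b ltm a0.
have [-> | b0] := eqVneq b 0.
  exists 0%N, (fun i => if i == 1%N then a else 0).
  by split=> // -[|i].
have [|k [s [s1 s2 sP sk sk1]]] := IH b (a %% b)%Z _ b0.
  exact: leq_trans (absz_modz_lt a b0) _.
exists k.+1, (fun i => if i is j.+2 then s j.+1 else a).
split=> // -[|[|i]] // ik; first by rewrite s1 s2.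
exact: (sP i.+1).
Qed.

Definition is_period (f : int -> nat) (T : int) : Prop :=
  0 < T /\ forall c : int, f (c + T) = f c.

Definition is_fundamental_period (f : int -> nat) (T : int) : Prop :=
  is_period f T /\ forall T' : int, is_period f T' -> T <= T'.

(* Main.v *)
Require Import Defs.
From mathcomp Require Import all_boot all_order all_algebra.
Import Order.TTheory GRing.Theory Num.Theory.
Local Open Scope ring_scope.

(** A call count [i <= k] means that [c = s i] modulo [s i.+1] and that no
    earlier congruence holds, so every common multiple of the moduli is a
    period.  Conversely, every count [1 <= i <= k] is attained, namely at
    [c = s i.+2]: for [j < i], [s i.+2] and [s j.+2] are distinct remainders
    modulo [s j.+1], whereas [s j = s j.+2] modulo [s j.+1].  If [T] is a
    period, [c] and [c + T] are then both congruent to [s i] modulo [s i.+1],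
    so [s i.+1] divides [T]. *)

Lemma dvdz_biglcm (I : Type) (r : seq I) (F : I -> int) (m : int) :
  (\big[lcmz/1]_(i <- r) F i %| m)%Z = all (fun i => F i %| m)%Z r.
Proof.
by elim: r => [|i r IH] /=; rewrite ?big_nil ?dvd1z // big_cons dvdz_lcm IH.
Qed.

(** [lcmz] is nonnegative whatever the signs, so it suffices that no factor vanishes. *)
Lemma biglcmz_gt0 (I : eqType) (r : seq I) (F : I -> int) :
  {in r, forall i, F i != 0} -> 0 < \big[lcmz/1]_(i <- r) F i.
Proof.
elim: r => [|i r IH] F0; rewrite ?big_nil // big_cons.
rewrite lt0r lcmz_ge0 lcmz_neq0 F0 ?mem_head // gt_eqF // IH // => j rj.
by rewrite F0 // inE rj orbT.
Qed.

Lemma dear_callsE (a b c : int) :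
  dear_calls a b c =
    if (b == 0) || (b %| c - a)%Z then 1%N else (dear_calls b (a %% b)%Z c).+1.
Proof.
rewrite /dear_calls dearE (sameP dvdz_mod0P eqP).
by do 2![case: ifP => //= _]; case: dear.
Qed.

(** Shifting the sequence mirrors the recursive call; the inductions below rest on this. *)
Lemma euclid_seq_step {a b : int} {k : nat} {s : nat -> int} :
  euclid_seq a b k.+1 s ->
  b != 0 /\ euclid_seq b (a %% b)%Z k (fun i => s i.+1).
Proof.
case=> s1 s2 sP sk sk1; have [] // := sP 1%N; rewrite s1 s2 => b0 s3.
by split=> //; split=> // i /andP[_ ik]; apply: sP.
Qed.

Lemma euclid_seq_neq0 (a b : int) (k : nat) (s : nat -> int) (i : nat) :
  euclid_seq a b k s -> (2 <= i < k.+2)%N -> s i != 0.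
Proof. by case=> _ _ sP _ _; case: i => // i /sP[]. Qed.

Lemma euclid_seq_bounds (a b : int) (k : nat) (s : nat -> int) (i : nat) :
  euclid_seq a b k s -> 0 <= b -> (i < k)%N -> 0 <= s i.+3 < b.
Proof.
elim: i a b k s => [|i IH] a b [|k] s // hs b_ge0 ik;
  have [b0 hs'] := euclid_seq_step hs;
  have ltrb : (a %% b)%Z < b by rewrite ltz_pmod // lt0r b0.
  by case: hs' => _ -> _ _ _; rewrite modz_ge0.
by have /andP[-> /lt_trans->] := IH _ _ _ _ hs' (modz_ge0 a b0) ik.
Qed.

(** Shifting [c] by a multiple of [b] leaves the first test unchanged; the later tests follow by
    induction. *)
Lemma dear_calls_period (a b : int) (k : nat) (s : nat -> int) (T c : int) :
  euclid_seq a b k s -> (forall i, (2 <= i < k.+2)%N -> (s i %| T)%Z) ->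
  dear_calls a b (c + T) = dear_calls a b c.
Proof.
elim: k a b s => [|k IH] a b s hs sT; rewrite !(dear_callsE a).
  by case: hs => _ -> _ _ ->; rewrite eqxx.
have [b0 hs'] := euclid_seq_step hs.
have bT : (b %| T)%Z by case: hs => _ <- _ _ _; apply: sT.
rewrite addrAC (rpredDr _ bT) (IH _ _ _ hs') // => i /andP[i2 ik].
by apply: sT; rewrite ltnS (ltnW i2).
Qed.

Lemma dear_calls_congr (a b : int) (k : nat) (s : nat -> int) (i : nat)
    (c : int) :
  euclid_seq a b k s -> (i < k)%N -> dear_calls a b c = i.+1 ->
  (s i.+2 %| c - s i.+1)%Z.
Proof.
elim: i a b k s => [|i IH] a b [|k] s // hs ik; rewrite dear_callsE;
  have [b0 hs'] := euclid_seq_step hs; rewrite (negPf b0) /=; case: ifP => //.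
- by case: hs => -> ->.
(* A failed first test triggers a further call, which itself counts at least 1, so the total exceeds
   1. *)
- by move=> _ []; rewrite dear_callsE; case: ifP.
- by move=> _ [/(IH _ _ _ _ hs' ik)].
Qed.

Lemma dear_calls_attained (a b : int) (k : nat) (s : nat -> int) (i : nat) :
  euclid_seq a b k s -> 0 <= b -> (i < k)%N ->
  dear_calls a b (s i.+3) = i.+1.
Proof.
elim: i a b k s => [|i IH] a b [|k] s // hs b_ge0 ik; rewrite dear_callsE;
  have [b0 hs'] := euclid_seq_step hs; rewrite (negPf b0) /=.
  case: hs' => _ -> _ _ _.
  by rewrite -eqz_mod_dvd modz_mod eqxx.
have r_ge0 := modz_ge0 a b0.
rewrite (IH _ _ _ _ hs') // -eqz_mod_dvd.
(* The first test must fail: [s i.+4] is its own remainder modulo [b] and is strictly below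
   [a %% b]. *)
rewrite modz_small ?(euclid_seq_bounds _ _ _ _ _ hs) //.
have /andP[_ ltr] := euclid_seq_bounds _ _ _ _ _ hs' r_ge0 ik.
by rewrite lt_eqF.
Qed.

Theorem theorem1 (a b : int) (hb : 1 <= b) (hab : b < a)
    (k : nat) (s : nat -> int) (hs : euclid_seq a b k s) :
  is_fundamental_period (fun c : int => dear_calls a b c)
    (\big[lcmz/1]_(2 <= i < k.+2) s i).
Proof.
have b_ge0 : 0 <= b by apply: le_trans hb.
set L := bigop _ _ _.
have dvdL m : reflect (forall i, (2 <= i < k.+2)%N -> (s i %| m)%Z) (L %| m)%Z.
  rewrite dvdz_biglcm; apply: (iffP allP) => sm i.
    by rewrite -mem_index_iota; apply: sm.
  by rewrite mem_index_iota; apply: sm.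
split; first split.
- by apply: biglcmz_gt0 => i; rewrite mem_index_iota; apply: euclid_seq_neq0 hs.
- by move=> c; apply: dear_calls_period hs _; apply/dvdL.
move=> T [T_gt0 perT].
suff /dvdL LT : forall i, (2 <= i < k.+2)%N -> (s i %| T)%Z.
  (* Divisibility compares only absolute values; [T] is its own since it is positive. *)
  rewrite -(gtr0_norm T_gt0) (le_trans (ler_norm L)) //.
  by rewrite lez_nat dvdn_leq // absz_gt0 gt_eqF.
move=> [|[|i]] // ik.
(* Call [i.+1] is the one that tests the modulus [s i.+2]; the witness [s i.+3] stops there. *)
have callsi := dear_calls_attained _ _ _ _ _ hs b_ge0 ik.
have d := dear_calls_congr _ _ _ _ _ _ hs ik callsi.
have := dear_calls_congr _ _ _ _ _ _ hs ik (etrans (perT _) callsi).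
by rewrite addrAC (rpredDl _ d).
Qed.
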